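(* Let $(\mathfrak h,(H_i,L_i)_{i\in I})$ be a linear Coxeter system with linear Coxeter group $\mathcal W$, closed fundamental chamber $\overline C$ and Tits cone $X$. Let $Y\subseteq X$ be a $\mathcal W$-invariant convex subcone containing $0$. Let $R_1,R_2\in\Upsilon$ such that $R_1\subseteq R_2$ and set $J:=\upsilon_*(R_1)\cap\upsilon^*(R_2)$. (a) The convex cone $R_2-R_1$ is a $\mathcal W_J$-invariant subcone of the Tits cone $X(J)$ such that $$(R_2-R_1)\cap\overline C(J)=(R_2\cap\overline C)+(R_1-R_1)=(R_2\cap\overline C)-(R_1\cap\overline C).$$ (b) A $\mathcal W_J$-equivariant isomorphism of partially ordered sets is given by $$[R_1,R_2]\to\mathrm{Fa}(R_2-R_1),\qquad R\mapsto R-R_1.$$ It also preserves the dimension of the faces.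
   Context: $\mathbb R^+=(0,\infty)$. A convex cone is a subset of a real vector space closed under addition and under multiplication by elements of $\mathbb R^+$. $\mathrm{ri}$ denotes the relative interior of a finite-dimensional convex set; for sets $S\pm T=\{s\pm t\mid s\in S,t\in T\}$. For a convex cone $K$ containing $0$, a face of $K$ is a convex cone $F\subseteq K$ with $(K\setminus F)+K\subseteq K\setminus F$; $\mathrm{Fa}(K)$ is the set of nonempty faces, ordered by inclusion. The dimension of a face is the dimension of its linear hull. Linear Coxeter systems. Let $\mathfrak h$ be a finite-dimensional real vector space, $n\ge1$, $I=\{1,\dots,n\}$. For a zero-based closed ray $H\subseteq\mathfrak h$ put $H^{\ge0}=\{\lambda\in\mathfrak h^*\mid\lambda(h)\ge0\ \forall h\in H\}$, $H^{>0}=\{\lambda\mid\lambda(h)>0\ \forall h\in H\setminus\{0\}\}$, $H^{=0}=\{\lambda\mid\lambda(h)=0\ \forall h\in H\}$. A linear Coxeter system $(\mathfrak h,(H_i,L_i)_{i\in I})$ consists of zero-based closed rays $H_i\subseteq\mathfrak h$, $L_i\subseteq\mathfrak h^*$ with $L_i\setminus\{0\}\subseteq H_i^{>0}$ such that: (1) the closed fundamental chamber $\overline C=\bigcap_{i\in I}H_i^{\ge0}$ spans $\mathfrak h^*$, and $\overline C\cap H_i^{=0}$, $i\in I$, are its pairwise different faces of codimension 1; (2) with $C=\bigcap_{i\in I}H_i^{>0}$ and $\mathcal W$ (the linear Coxeter group) the group generated by the reflections $\sigma_i$ on $\mathfrak h^*$ at the hyperplane $H_i^{=0}$ along the line $L_i\cup(-L_i)$,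 one has $\sigma C\cap C=\emptyset$ for all $\sigma\in\mathcal W\setminus\{1\}$. $\mathcal W_J$ is the subgroup generated by $\sigma_j$, $j\in J$. The Tits cone is the convex cone $X=\bigcup_{\sigma\in\mathcal W}\sigma\overline C$. For $\emptyset\ne J\subseteq I$, $(\mathfrak h,(H_i,L_i)_{i\in J})$ is again a linear Coxeter system, with group $\mathcal W_J$, closed fundamental chamber $\overline C(J)=\bigcap_{i\in J}H_i^{\ge0}$ and Tits cone $X(J)=\bigcup_{\sigma\in\mathcal W_J}\sigma\overline C(J)$. By convention $\overline C(\emptyset)=X(\emptyset)=\mathfrak h^*$. $\Upsilon=\{R\in\mathrm{Fa}(Y)\mid\mathrm{ri}(R)\cap\overline C\ne\emptyset\}$. For $R\in\Upsilon$: $\upsilon(R)=\{i\in I\mid\sigma_iR=R\}$, $\upsilon_*(R)=\{i\in I\mid\sigma_i\text{ fixes }R\text{ pointwise}\}$, $\upsilon^*(R)=\upsilon(R)\setminus\upsilon_*(R)$. For $R_1\subseteq R_2$ in $\mathrm{Fa}(Y)$: $[R_1,R_2]=\{R\in\mathrm{Fa}(Y)\mid R_1\subseteq R\subseteq R_2\}$. *)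

(* Defs.v *)
From HB Require Import structures.
From mathcomp Require Import all_boot all_order all_algebra.
From mathcomp Require Import boolp classical_sets functions reals.
From mathcomp Require Import topology normedtype.

Set Implicit Arguments.
Unset Strict Implicit.
Unset Printing Implicit Defensive.

Import Order.TTheory GRing.Theory Num.Theory.
Import numFieldNormedType.Exports.

Local Open Scope classical_set_scope.
Local Open Scope ring_scope.

Section Convex.
Variables (R : realType) (V : vectType R).
Implicit Types (S T K F : set V).

Definition set_add S T : set V := [set s + t | s in S & t in T].
Definition set_sub S T : set V := [set s - t | s in S & t in T].

(* Closed under multiplication by positive scalars only: a cone may be empty
   and need not contain 0. *)
Definition convex_cone K : Prop :=
  (forall x y, K x -> K y -> K (x + y)) /\
  (forall (a : R) x, 0 < a -> K x -> K (a *: x)).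

Definition is_face K F : Prop :=
  [/\ convex_cone F, F `<=` K & set_add (K `\` F) K `<=` K `\` F].

Definition Fa K : set (set V) := [set F | is_face K F /\ F !=set0].

Definition is_linear_hull S (U : {vspace V}) : Prop :=
  (forall x, S x -> x \in U) /\
  (forall U' : {vspace V}, (forall x, S x -> x \in U') -> (U <= U')%VS).

Definition linear_hull S : {vspace V} := xget 0%VS (is_linear_hull S).

(* [linear_hull] never takes its default value. *)
Lemma linear_hullP S : is_linear_hull S (linear_hull S).
Proof.
suff [U hU] : exists U, is_linear_hull S U.
  by rewrite /linear_hull; case: xgetP => [y _ //|/(_ U)].
pose P d := `[< exists2 U : {vspace V},
                (forall x, S x -> x \in U) & \dim U = d >].
have exP : exists d, P d.
  by exists (\dim {:V}); apply/asboolP; exists fullv => // x _; rewrite memvf.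
case: (ex_minnP exP) => d /asboolP[U SU dU] dmin.
exists U; split=> // U' SU'.
have UU' : (U :&: U' <= U)%VS by exact: capvSl.
suff /eqP <- : (U :&: U')%VS == U by exact: capvSr.
rewrite eqEdim UU' dU; apply: dmin; apply/asboolP.
by exists (U :&: U')%VS => // x Sx; rewrite memv_cap SU ?SU'.
Qed.

Definition cone_dim S : nat := \dim (linear_hull S).

Definition affine_hull S : set V :=
  [set x | exists (m : nat) (a : 'I_m -> R) (p : 'I_m -> V),
    [/\ forall i, S (p i), \sum_i a i = 1 & x = \sum_i a i *: p i]].

(* Interior relative to the affine hull. The topology of the finite-dimensional
   space V is read off in coordinates; it does not depend on the basis. *)
Definition ri S : set V :=
  [set x | S x /\ exists2 e : R, 0 < e &
    forall y, affine_hull S y ->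
      ball (passmx.rVof (vbasis {:V}) x) e (passmx.rVof (vbasis {:V}) y) -> S y].

End Convex.

Section Rays.
Variables (R : realType) (h : vectType R).
Local Notation dual := 'Hom(h, R^o).
Implicit Types (A : set h) (L : set dual).

Definition closed_ray (V : vectType R) (A : set V) : Prop :=
  exists2 v : V, v != 0 & A = [set a *: v | a in [set a : R | 0 <= a]].

Definition half_ge0 A : set dual := [set l | forall x, A x -> 0 <= (l x : R)].
Definition half_gt0 A : set dual :=
  [set l | forall x, A x -> x != 0 -> 0 < (l x : R)].
Definition hyper_eq0 A : set dual := [set l | forall x, A x -> l x = 0].

Definition is_reflection A L (s : 'End(dual)) : Prop :=
  (forall l, hyper_eq0 A l -> s l = l) /\ (forall l, L l -> s l = - l).

Definition reflection A L : 'End(dual) := xget \1%VF (is_reflection A L).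

(* For the rays of a linear Coxeter system, [reflection] is the unique
   reflection at the hyperplane [hyper_eq0 A] along the line spanned by L. *)
Lemma reflectionP A L : closed_ray A -> closed_ray L ->
    (forall l, L l -> l != 0 -> half_gt0 A l) ->
  is_reflection A L (reflection A L) /\
  (forall s, is_reflection A L s -> s = reflection A L).
Proof.
move=> [v v0 AE] [b b0 LE] LA.
have Lb : L b by rewrite LE; exists 1; rewrite /= ?ler01 ?scale1r.
have Av : A v by rewrite AE; exists 1; rewrite /= ?ler01 ?scale1r.
have bv0 : (b v : R) != 0 by rewrite gt_eqF ?(LA b Lb b0 v).
have hypE (l : dual) : l v = 0 -> hyper_eq0 A l.
  by move=> lv x; rewrite AE => -[a _ <-]; rewrite linearZ /= lv scaler0.
have evE (l : dual) (c : R) : (l - c *: b) v = l v - c * (b v : R) :> R.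
  by rewrite add_lfunE opp_lfunE scale_lfunE.
have uniq s t : is_reflection A L s -> is_reflection A L t -> s = t.
  move=> [s1 s2] [t1 t2]; apply/lfunP => l.
  pose c : R := (l v : R) / (b v : R).
  have h0 : hyper_eq0 A (l - c *: b).
    by apply: hypE; rewrite evE /c divfK // subrr.
  have -> : l = (l - c *: b) + c *: b by rewrite subrK.
  rewrite [s _]raddfD [t _]raddfD /= (s1 _ h0) (t1 _ h0).
  by rewrite [s _]linearZ [t _]linearZ /= (s2 _ Lb) (t2 _ Lb).
pose f (l : dual) : dual := l - (2 * (l v : R) / (b v : R)) *: b.
have flin : linear f.
  move=> a x y; rewrite /f scalerBr scalerA.
  have -> : 2 * ((a *: x + y) v : R) / (b v : R)
            = a * (2 * (x v : R) / (b v : R)) + 2 * (y v : R) / (b v : R) :> R.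
    by rewrite add_lfunE scale_lfunE /GRing.scale /= mulrDr mulrDl !mulrA [2 * a]mulrC.
  by rewrite scalerDl opprD addrACA.
pose fL := GRing.isLinear.Build _ _ _ _ f flin.
pose F : {linear dual -> dual} := HB.pack f fL.
have isF : is_reflection A L (linfun F).
  split=> l; rewrite lfunE /= /f.
    by move=> /(_ v Av) ->; rewrite mulr0 mul0r scale0r subr0.
  rewrite LE => -[a _ <-].
  have -> : 2 * ((a *: b) v : R) / (b v : R) = 2 * a :> R.
    by rewrite scale_lfunE /GRing.scale /= mulrA mulfK.
  by rewrite -scalerBl mulr_natl mulr2n opprD addNKr scaleNr.
have isr : is_reflection A L (reflection A L).
  by rewrite /reflection; case: xgetP => [y _ //|/(_ (linfun F))].
by split=> // s hs; apply: uniq.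
Qed.

End Rays.

Section Coxeter.
Variables (R : realType) (h : vectType R) (n : nat).
Local Notation dual := 'Hom(h, R^o).
Variables (H : 'I_n -> set h) (L : 'I_n -> set dual).
Implicit Types (J : set 'I_n) (Y : set dual).

Definition sigma (i : 'I_n) : 'End(dual) := reflection (H i) (L i).

(* The group W_J generated by the reflections sigma j, j in J. *)
Inductive coxgroup J : 'End(dual) -> Prop :=
| coxgroup_id : coxgroup J \1%VF
| coxgroup_gen j : J j -> coxgroup J (sigma j)
| coxgroup_comp s t : coxgroup J s -> coxgroup J t -> coxgroup J (s \o t)%VF
| coxgroup_inv s : coxgroup J s -> coxgroup J (s^-1)%VF.

(* For J empty, [closed_chamber J] and [tits_cone J] are the whole dual space. *)
Definition closed_chamber J : set dual := \bigcap_(i in J) half_ge0 (H i).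
Definition open_chamber : set dual := \bigcap_(i in setT) half_gt0 (H i).
Definition tits_cone J : set dual :=
  \bigcup_(s in coxgroup J) (s @` closed_chamber J).

Definition wall (i : 'I_n) : set dual :=
  closed_chamber setT `&` hyper_eq0 (H i).

Record linear_coxeter_system : Prop := LinearCoxeterSystem {
  lcs_rayH : forall i, closed_ray (H i);
  lcs_rayL : forall i, closed_ray (L i);
  lcs_pos : forall i, L i `\ 0 `<=` half_gt0 (H i);
  lcs_span : linear_hull (closed_chamber setT) = fullv;
  lcs_wall_inj : injective wall;
  lcs_wall_face : forall F,
    (Fa (closed_chamber setT) F /\
       (cone_dim F).+1 = cone_dim (closed_chamber setT)) <->
    exists i, F = wall i;
  lcs_free : forall s, coxgroup setT s -> s != \1%VF ->
    (s @` open_chamber) `&` open_chamber = set0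
}.

Definition W_invariant J Y : Prop := forall s, coxgroup J s -> s @` Y = Y.

Definition Upsilon Y : set (set dual) :=
  [set F | Fa Y F /\ (ri F `&` closed_chamber setT) !=set0].

Definition upsilon (F : set dual) : set 'I_n := [set i | sigma i @` F = F].
Definition upsilon_lower (F : set dual) : set 'I_n :=
  [set i | forall x, F x -> sigma i x = x].
Definition upsilon_upper (F : set dual) : set 'I_n :=
  upsilon F `\` upsilon_lower F.

Definition face_interval Y (R1 R2 : set dual) : set (set dual) :=
  [set F | [/\ Fa Y F, R1 `<=` F & F `<=` R2]].

End Coxeter.

(* Main.v *)
(** The convex-geometric content is elementary once one knows that the Tits cone
    X lies in X(J) for every J, and that every R in Upsilon has a point e, internal
    in R and in the closed chamber, lying only on the walls that contain R.

    For X <= X(J): by freeness no chamber wC meets a reflecting hyperplane, so it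
    lies on one side of each.  If a hyperplane H_j separates the adjacent chambers
    vC and v sigma_i C, then it supports their common facet and, again by freeness,
    sigma_j v sigma_i = v.  Induction on words thus folds every chamber, hence X,
    into the chamber of J by an element of W_J.

    For e: among the internal points of R in the closed chamber take one on as few
    walls as possible; J being the set of these walls, W_J fixes e and preserves R,
    so any x in R can be folded to some u x in the chamber of J, and minimality for
    N e + u x forces u x, hence x, onto all these walls.

    With such an e for R_1, adding a large multiple of e to an element of
    (R_2 - R_1) in the chamber of J moves it into the closed chamber of I.  The
    inverse of R |-> R - R_1 is G |-> G /\ R_2. *)
Require Import Defs.
From HB Require Import structures.
From mathcomp Require Import all_boot all_order all_algebra.
From mathcomp Require Import boolp classical_sets functions reals.
From mathcomp Require Import topology normedtype lra.

Set Implicit Arguments.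
Unset Strict Implicit.
Unset Printing Implicit Defensive.

Import Order.TTheory GRing.Theory Num.Theory.
Import numFieldNormedType.Exports.

Local Open Scope classical_set_scope.
Local Open Scope ring_scope.

(** Lets a large multiple of one point absorb any perturbation by another, keeping finitely many
    strict inequalities at once. *)
Lemma exists_large_scale (R : realFieldType) (I : finType) (f g : I -> R) :
  exists2 N : R, 0 < N & forall i, 0 < f i -> 0 < g i + N * f i.
Proof.
(* Where [f i = 0] the quotient is [0] by convention, so such indices add nothing to the sum. *)
pose F i := `|g i| / `|f i|.
have F0 i : 0 <= F i by rewrite divr_ge0.
have S0 : 0 <= \sum_i F i by rewrite sumr_ge0.
exists (1 + \sum_i F i) => [|i fi]; first by rewrite ltr_pwDl.
have gF : F i * f i = `|g i| by rewrite /F (gtr0_norm fi) divfK ?gt_eqF.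
have le_F : F i <= \sum_i F i.
  by rewrite (bigD1 i) //= lerDl sumr_ge0.
have : F i * f i <= (\sum_i F i) * f i by rewrite ler_wpM2r // ltW.
have := ler_norm (- g i); rewrite normrN gF.
lra.
Qed.

(** * Faces of convex cones *)

Section ConvexCones.
Variables (R : realType) (V : vectType R).
Implicit Types (S T K F G : set V).

Lemma convex_cone_sub S T :
  convex_cone S -> convex_cone T -> convex_cone (set_sub S T).
Proof.
move=> [SD SZ] [TD TZ]; split=> [_ _ [s Ss [t Tt <-]] [s' Ss' [t' Tt' <-]]|].
  exists (s + s'); first exact: SD.
  by exists (t + t'); [exact: TD | rewrite opprD addrACA].
move=> a _ a0 [s Ss [t Tt <-]].
exists (a *: s); first exact: SZ.
by exists (a *: t); [exact: TZ | rewrite scalerBr].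
Qed.

Lemma is_faceP K F : convex_cone K ->
  is_face K F <->
  [/\ convex_cone F, F `<=` K & forall x y, K x -> K y -> F (x + y) -> F x].
Proof.
move=> [KD _]; split=> [[Fc FK KF]|[Fc FK KF]]; split=> //.
  move=> x y Kx Ky Fxy; apply: contrapT => Fx.
  by have [|_ /(_ Fxy)] := KF (x + y); first by exists x => //; exists y.
move=> _ [x [Kx Fx] [y Ky <-]]; split; first exact: KD.
by move/(KF _ _ Kx Ky).
Qed.

Lemma face_addl K F x y : is_face K F -> K x -> K y -> F (x + y) -> F x.
Proof.
move=> [_ _ KF] Kx Ky Fxy; apply: contrapT => Fx.
by have [|_ /(_ Fxy)] := KF (x + y); first by exists x => //; exists y.
Qed.

Lemma face_addr K F x y : is_face K F -> K x -> K y -> F (x + y) -> F y.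
Proof. by move=> FK Kx Ky; rewrite addrC; exact: face_addl FK Ky Kx. Qed.

Lemma face0 K F : K 0 -> Fa K F -> F 0.
Proof.
move=> K0 [FK [x Fx]]; have [_ sFK _] := FK.
by apply: (face_addl FK K0 (sFK _ Fx)); rewrite add0r.
Qed.

Lemma sub_face K F G : convex_cone K -> is_face K F -> G `<=` F ->
  is_face F G <-> is_face K G.
Proof.
move=> Kc FK GF; have [Fc sFK _] := FK.
split=> [/(is_faceP _ Fc)[Gc _ FG]|GK].
  apply/(is_faceP _ Kc); split=> // [|x y Kx Ky Gxy]; first exact: subset_trans sFK.
  have Fxy := GF _ Gxy; apply: (FG x y) Gxy.
    exact: face_addl FK Kx Ky Fxy.
  exact: face_addr FK Kx Ky Fxy.
have [Gc _ _] := GK; apply/(is_faceP _ Fc); split=> // x y Fx Fy.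
by apply: face_addl GK _ _; exact: sFK.
Qed.

Lemma face_sub K F G : convex_cone K -> is_face K F -> convex_cone G ->
  G `<=` F -> is_face (set_sub K G) (set_sub F G).
Proof.
move=> Kc FK Gc GF; have [Fc sFK _] := FK; have [FD _] := Fc; have [KD _] := Kc.
apply/(is_faceP _ (convex_cone_sub Kc Gc)).
split=> [|x [f Ff [g Gg <-]]|]; first exact: convex_cone_sub.
  by exists f; [exact: sFK | exists g].
move=> _ _ [x Kx [g Gg <-]] [y Ky [g' Gg' <-]] [f Ff [r Gr]] fE.
(* Moving the subtracted terms across gives [x + (y + r) = f + (g + g')]: a sum of two elements of
   [K] that lies in [F]. *)
exists x => //; last by exists g.
apply: (face_addl (y := y + r) FK) => //.
  by apply: KD => //; apply: sFK; exact: GF.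
suff -> : x + (y + r) = f + (g + g') by apply: (FD) => //; apply: FD; exact: GF.
by rewrite -[f](subrK r) fE [x - g + _]addrACA -opprD [RHS]addrAC subrK addrA.
Qed.

(** From [x = f - g] the sum [x + g] lies in [F]. For [0] in [G] this recovers [F] from
    [set_sub F G] by intersecting with [K], whence injectivity of the face map. *)
Lemma face_sub_restrict K F G x : convex_cone K -> is_face K F -> G `<=` F ->
  K x -> set_sub F G x -> F x.
Proof.
move=> [KD _] FK GF Kx [f Ff [g Gg fE]].
have [_ sFK _] := FK.
by apply: (face_addl (y := g) FK) => //; [apply: sFK; exact: GF | rewrite -fE subrK].
Qed.

Lemma face_sub_le K F F' G : convex_cone K -> is_face K F -> is_face K F' ->
  G 0 -> G `<=` F' -> set_sub F G `<=` set_sub F' G -> F `<=` F'.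
Proof.
move=> Kc [_ sFK _] F'K G0 GF' FF' x Fx.
apply: (face_sub_restrict Kc F'K GF' (sFK _ Fx)); apply: FF'.
by exists x => //; exists 0 => //; rewrite subr0.
Qed.

Lemma face_sub_surj K F G : convex_cone K -> convex_cone F -> F `<=` K -> F 0 ->
  Fa (set_sub K F) G ->
  [/\ is_face K (G `&` K), F `<=` G `&` K & set_sub (G `&` K) F = G].
Proof.
move=> Kc Fc FK F0 FaG; have [GKF [_ _]] := FaG.
have Dc := convex_cone_sub Kc Fc.
have [Gc sG GP] := (is_faceP _ Dc).1 GKF; have [GD GZ] := Gc.
have [KD KZ] := Kc.
have sKD x : K x -> set_sub K F x.
  by move=> Kx; exists x => //; exists 0; rewrite ?subr0.
have D0 : set_sub K F 0 by apply/sKD/FK.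
have G0 : G 0 by exact: face0 D0 FaG.
(* Both [f] and [- f] lie in [set_sub K F] and add up to [0], so the face [G] contains both. *)
have FG f : F f -> G f /\ G (- f).
  move=> Ff; have Df : set_sub K F f by apply/sKD/FK.
  have DNf : set_sub K F (- f).
    by exists 0; [exact: FK | exists f => //; rewrite sub0r].
  by split; [apply: (GP _ (- f)) | apply: (GP _ f)]; rewrite ?subrr ?addNr.
have FGK : F `<=` G `&` K by move=> f Ff; split; [have [] := FG f Ff | exact: FK].
split=> //.
  apply/(is_faceP _ Kc); split.
  - split=> [x y [Gx Kx] [Gy Ky]|a x a0 [Gx Kx]]; split.
    + exact: GD.
    + exact: KD.
    + exact: GZ.
    + exact: KZ.
  - by move=> x [].
  - by move=> x y Kx Ky [Gxy _]; split=> //; apply: (GP x y); auto.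
apply/seteqP; split=> [_ [x [Gx _] [f Ff <-]]|x Gx].
  by apply: GD => //; have [] := FG f Ff.
have [k Kk [f Ff kE]] := sG _ Gx; exists k; last by exists f.
by split=> //; rewrite -[k](subrK f) kE; apply: GD => //; have [] := FG f Ff.
Qed.

(** Since [0] is in [T], the set [S] lies in [set_sub S T], which lies in the span of [S]. *)
Lemma cone_dim_sub S T : T 0 -> T `<=` S -> cone_dim (set_sub S T) = cone_dim S.
Proof.
move=> T0 TS; rewrite /cone_dim.
have [hS minS] := linear_hullP S; have [hD minD] := linear_hullP (set_sub S T).
congr (\dim _); apply/eqP; rewrite eqEsubv; apply/andP; split.
  apply: minD => _ [s Ss [t Tt <-]].
  by apply: memvB; [exact: hS | apply: hS; exact: TS].
by apply: minS => x Sx; apply: hD; exists x => //; exists 0; rewrite ?subr0.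
Qed.

(** An algebraic substitute for the relative interior of a cone: up to scaling, every segment of [S]
    ending in [e] extends beyond [e]. *)
Definition internal S (e : V) : Prop :=
  S e /\ forall x, S x -> exists2 t : R, 0 < t & S (t *: e - x).

Lemma internal_add S e x : convex_cone S -> internal S e -> S x ->
  internal S (e + x).
Proof.
move=> [SD SZ] [Se ie] Sx; split=> [|y Sy]; first exact: SD.
have [t t0 Sty] := ie y Sy; exists t => //.
by rewrite scalerDr addrAC; apply: SD => //; exact: SZ.
Qed.

Lemma internalZ S e (a : R) : convex_cone S -> 0 < a -> internal S e ->
  internal S (a *: e).
Proof.
move=> [SD SZ] a0 [Se ie]; split=> [|y Sy]; first exact: SZ.
have [t t0 Sty] := ie y Sy; exists (t / a); first exact: divr_gt0.
by rewrite scalerA divfK ?gt_eqF.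
Qed.

Lemma internal_sub_face K F S e : is_face K F -> S `<=` K -> internal S e ->
  F e -> S `<=` F.
Proof.
move=> FK SK [_ ie] Fe x Sx; have [t t0 Stx] := ie x Sx.
have [[_ FZ] _ _] := FK.
apply: (face_addr (x := t *: e - x) FK); [exact: SK | exact: SK |].
by rewrite subrK; exact: FZ.
Qed.

Lemma ri_internal S e : convex_cone S -> ri S e -> internal S e.
Proof.
move=> [SD SZ] [Se [eps eps0 riS]]; split=> // x Sx.
pose u := passmx.rVof (vbasis {:V}) (e - x).
(* [N] bounds every coordinate of [u] by [N * eps], so the step [d *: (e - x)] with [d = N^-1] stays
   inside the ball. *)
have [N N0 uN] := exists_large_scale (fun=> eps) (fun j => - `|u 0 j|).
pose d := N^-1; have d0 : 0 < d by rewrite invr_gt0.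
have Sy : S (e + d *: (e - x)).
  apply: riS.
    exists 2%N, (fun i : 'I_2 => if i == ord0 then 1 + d else - d),
      (fun i : 'I_2 => if i == ord0 then e else x).
    split; first by move=> i; case: ifP.
      by rewrite !big_ord_recl big_ord0 /= addr0 addrK.
    rewrite !big_ord_recl big_ord0 /= addr0 scalerDl scale1r scalerBr.
    by rewrite scaleNr addrA.
  split=> // i j; rewrite addrC passmx.rVof_linear addrC -/u ord1 !mxE.
  rewrite /ball /= opprD addNKr normrN normrM gtr0_norm //.
  have := uN j eps0; rewrite addrC subr_gt0 /d.
  by rewrite ltr_pdivrMl // /u mxE.
(* Scaling [e + d *: (e - x)] by [N] turns the coefficient of [x] into [-1]. *)
exists (N * (1 + d)); first by rewrite mulr_gt0 // addr_gt0.
suff -> : (N * (1 + d)) *: e - x = N *: (e + d *: (e - x)) by exact: SZ.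
rewrite mulrDr mulr1 mulfV ?gt_eqF // scalerDl scale1r scalerDr scalerA.
by rewrite mulfV ?gt_eqF // scale1r addrA.
Qed.

End ConvexCones.
(** * Chambers and the Tits cone *)

Section CoxeterSystems.
Variables (R : realType) (h : vectType R) (n : nat).
Local Notation dual := 'Hom(h, R^o).
Variables (H : 'I_n -> set h) (L : 'I_n -> set dual).
Hypothesis hHL : linear_coxeter_system H L.
Implicit Types (i j k : 'I_n) (J : set 'I_n) (Y F : set dual) (l x c d p q m : dual).

(** * Coroots, roots and the reflection formula *)

Definition coroot i : h :=
  xget 0 [set v | v != 0 /\ H i = [set a *: v | a in [set a : R | 0 <= a]]].

Local Notation sigma := (sigma H L).
Local Notation coxgroup := (coxgroup H L).
Local Notation chamber := (closed_chamber H).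
Local Notation "<< l , i >>" := (l (coroot i) : R) (format "<< l ,  i >>").

(** The default [0] is never taken. The ray determines its generator only up to a positive factor,
    so chambers and walls depend only on signs and zeros of pairings. *)
Lemma coroot_ray i :
  coroot i != 0 /\ H i = [set a *: coroot i | a in [set a : R | 0 <= a]].
Proof.
have [v v0 vE] := lcs_rayH hHL i.
by rewrite /coroot; case: xgetP => [y -> //|/(_ v)[]].
Qed.

Lemma pairD i l x : << l + x , i >> = << l , i >> + << x , i >>.
Proof. by rewrite add_lfunE. Qed.

Lemma pairZ i (a : R) l : << a *: l , i >> = a * << l , i >>.
Proof. by rewrite scale_lfunE. Qed.

Lemma pairB i l x : << l - x , i >> = << l , i >> - << x , i >>.
Proof. by rewrite add_lfunE opp_lfunE. Qed.

Lemma pair0 i : << (0 : dual) , i >> = 0.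
Proof. by rewrite zero_lfunE. Qed.

Lemma pair_sum (I : finType) (P : pred I) (F : I -> dual) i :
  << \sum_(k | P k) F k , i >> = \sum_(k | P k) << F k , i >>.
Proof.
by apply: (big_morph (fun l => << l , i >>)) => [x y|]; [exact: pairD | exact: pair0].
Qed.

Let H_coroot i : H i (coroot i).
Proof. by have [_ ->] := coroot_ray i; exists 1; rewrite /= ?ler01 ?scale1r. Qed.

Lemma half_ge0E i l : half_ge0 (H i) l <-> 0 <= << l , i >>.
Proof.
split=> [|l0 x]; first by apply.
have [_ ->] := coroot_ray i; case=> a a0 <-.
by rewrite linearZ mulr_ge0.
Qed.

Lemma half_gt0E i l : Defs.half_gt0 (H i) l <-> 0 < << l , i >>.
Proof.
have [v0 HE] := coroot_ray i.
split=> [|l0 x]; first by apply.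
rewrite HE => -[a /= a0 <-]; rewrite scaler_eq0 negb_or => /andP[an0 _].
by rewrite linearZ mulr_gt0 // lt_def an0.
Qed.

Lemma hyper_eq0E i l : hyper_eq0 (H i) l <-> << l , i >> = 0.
Proof.
split=> [|l0 x]; first by apply.
have [_ ->] := coroot_ray i; case=> a a0 <-.
by rewrite linearZ /= l0 scaler0.
Qed.

Lemma closed_chamberE J l : chamber J l <-> forall i, J i -> 0 <= << l , i >>.
Proof. by split=> lJ i Ji; apply/half_ge0E/lJ. Qed.

Lemma open_chamberE l : open_chamber H l <-> forall i, 0 < << l , i >>.
Proof. by split=> lJ i; [apply/half_gt0E/lJ | move=> _; apply/half_gt0E/lJ]. Qed.

Lemma wallE i l : wall H i l <-> chamber setT l /\ << l , i >> = 0.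
Proof. by split=> -[lC /hyper_eq0E li]. Qed.

(** Scaling a generator of [L i] to pair to [2] with the coroot yields the usual reflection
    formula. *)
Lemma exists_root i : exists r : dual,
  << r , i >> = 2 /\ forall l, sigma i l = l - << l , i >> *: r.
Proof.
have [b b0 LE] := lcs_rayL hHL i.
have Lb : L i b by rewrite LE; exists 1; rewrite /= ?ler01 ?scale1r.
have Lpos l : L i l -> l != 0 -> Defs.half_gt0 (H i) l.
  by move=> Ll /eqP l0; apply: (lcs_pos hHL); split.
have bi : 0 < << b , i >> by apply/half_gt0E/Lpos.
have [[s1 s2] _] := reflectionP (lcs_rayH hHL i) (lcs_rayL hHL i) Lpos.
rewrite -/(sigma i) in s1 s2.
have ri : << (2 / << b , i >>) *: b , i >> = 2 by rewrite pairZ divfK ?gt_eqF.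
have s_r a : sigma i (a *: ((2 / << b , i >>) *: b)) =
    - (a *: ((2 / << b , i >>) *: b)).
  by rewrite scalerA [sigma i _]linearZ /= s2 ?scalerN.
move: (_ *: b) ri s_r => r ri s_r; exists r; split=> // l.
have -> : sigma i l = sigma i ((l - (<< l , i >> / 2) *: r) + (<< l , i >> / 2) *: r).
  by rewrite subrK.
rewrite linearD /= s1; last first.
  by apply/hyper_eq0E; rewrite pairB pairZ ri divfK ?subrr // pnatr_eq0.
rewrite s_r -addrA -opprD -scalerDl.
by rewrite -splitr.
Qed.

Definition root i : dual := sval (cid (exists_root i)).

Lemma rootP i :
  << root i , i >> = 2 /\ forall l, sigma i l = l - << l , i >> *: root i.
Proof. exact: svalP (cid (exists_root i)). Qed.

Lemma sigmaE i l : sigma i l = l - << l , i >> *: root i.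
Proof. by have [] := rootP i. Qed.

Lemma pair_sigma i l : << sigma i l , i >> = - << l , i >>.
Proof.
have [r2 _] := rootP i.
by rewrite sigmaE pairB pairZ r2 mulr_natr mulr2n opprD addNKr.
Qed.

Lemma sigmaK i : involutive (sigma i).
Proof.
by move=> l; rewrite sigmaE pair_sigma scaleNr opprK sigmaE subrK.
Qed.

Lemma sigma_fix i l : (sigma i l == l) = (<< l , i >> == 0).
Proof.
have [r2 sE] := rootP i; apply/eqP/eqP => [sl|l0]; last first.
  by rewrite sE l0 scale0r subr0.
have := pair_sigma i l; rewrite sl => /eqP.
by rewrite -subr_eq0 opprK -mulr2n mulrn_eq0 => /eqP.
Qed.

(** * Group elements as words in the reflections *)

Lemma coxgroup_lker0 J s : coxgroup J s -> lker s == 0%VS.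
Proof.
elim=> [|j _|s1 t _ s0 _ t0|s1 _ s0].
- by apply/lker0P => x y; rewrite !id_lfunE.
- by apply/lker0P/inv_inj/sigmaK.
- apply/lker0P => x y; rewrite !comp_lfunE /= => /(lker0P s0).
  exact: (lker0P t0).
(* By induction [s1] has trivial kernel, so [s1^-1] is a genuine inverse. *)
- apply/lker0P => x y /(congr1 s1).
  by rewrite !lker0_lfunVK.
Qed.

Lemma coxgroupW J J' s : J `<=` J' -> coxgroup J s -> coxgroup J' s.
Proof.
move=> JJ'; elim=> [|j Jj|s1 t _ Ws _ Wt|s1 _ Ws].
- exact: coxgroup_id.
- exact/coxgroup_gen/JJ'.
- exact: coxgroup_comp.
- exact: coxgroup_inv.
Qed.

Lemma inv_lfun_unique (s t : 'End(dual)) :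
  lker s == 0%VS -> (s \o t)%VF = \1%VF -> (s^-1)%VF = t.
Proof. by move=> s0 st; rewrite -[RHS](lker0_compKf s0) st comp_lfun1r. Qed.

Lemma coxgroup_word_ind J (P : 'End(dual) -> Prop) :
  P \1%VF -> (forall s j, J j -> P s -> P (s \o sigma j)%VF) ->
  forall s, coxgroup J s -> P s.
Proof.
move=> P1 Ps s Ws.
(* Strengthened to right multiplication by [s] and by its inverse, so that the induction passes
   through [coxgroup_inv]. *)
suff : (forall t, P t -> P (t \o s)%VF) /\ (forall t, P t -> P (t \o s^-1)%VF).
  by case=> /(_ _ P1) + _; rewrite comp_lfun1l.
elim: Ws => [|j Jj|s1 s2 Ws1 [IH1 IH1'] Ws2 [IH2 IH2']|s1 Ws1 [IH1 IH1']].
- have -> : (\1^-1 = \1 :> 'End(dual))%VF.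
    apply: inv_lfun_unique; last by rewrite comp_lfun1l.
    by apply/lker0P => x y; rewrite !id_lfunE.
  by split=> t; rewrite comp_lfun1r.
- have -> : ((sigma j)^-1 = sigma j)%VF.
    apply: inv_lfun_unique; first exact/lker0P/inv_inj/sigmaK.
    by apply/lfunP => x; rewrite comp_lfunE id_lfunE sigmaK.
  by split=> t; exact: Ps.
- have -> : ((s1 \o s2)^-1 = s2^-1 \o s1^-1)%VF.
    apply: inv_lfun_unique; first exact/coxgroup_lker0/(coxgroup_comp Ws1 Ws2).
    rewrite comp_lfunA -(comp_lfunA s1) lker0_compfV ?(coxgroup_lker0 Ws2) //.
    by rewrite comp_lfun1r lker0_compfV ?(coxgroup_lker0 Ws1).
  by split=> t Pt; rewrite comp_lfunA; [apply/IH2/IH1 | apply/IH1'/IH2'].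
- have s10 := coxgroup_lker0 Ws1.
  have -> : (s1^-1^-1 = s1)%VF.
    apply: inv_lfun_unique; last exact: lker0_compVf.
    exact/coxgroup_lker0/coxgroup_inv/Ws1.
  by [].
Qed.

(** * Hyperplanes and interior points of the chamber and its walls *)

Lemma exists_hyperplane i : exists2 U : {vspace dual},
  forall l, l \in U <-> << l , i >> = 0 & (\dim U).+1 = \dim {:dual}.
Proof.
have ev_linear : linear (fun l : dual => l (coroot i) : R^o).
  by move=> a x y; rewrite pairD pairZ.
pose evL := GRing.isLinear.Build _ _ _ _ _ ev_linear.
pose ev : {linear dual -> R^o} := HB.pack (fun l : dual => l (coroot i) : R^o) evL.
exists (lker (linfun ev)) => [l|].
  by rewrite memv_ker lfunE; split=> [/eqP|/eqP].
have := limg_ker_dim (linfun ev) fullv; rewrite capfv => <-.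
suff -> : limg (linfun ev) = fullv by rewrite dimvf addn1.
apply/eqP; rewrite eqEdim subvf dimvf /= lt0n dimv_eq0.
apply/negP => /eqP img0; have := memv_img (linfun ev) (memvf (root i)).
rewrite img0 memv0 lfunE /=; have [-> _] := rootP i.
by rewrite pnatr_eq0.
Qed.

Lemma pair_sum_gt0 (P : pred 'I_n) (x : 'I_n -> dual) j :
  (forall k, P k -> 0 <= << x k , j >>) -> P j -> 0 < << x j , j >> ->
  0 < << \sum_(k | P k) x k , j >>.
Proof.
move=> x0 Pj xj; rewrite pair_sum (bigD1 j) //= ltr_pwDl //.
by apply: sumr_ge0 => k /andP[Pk _]; exact: x0.
Qed.

(** If some pairing vanished on the closed chamber, its span would lie in a hyperplane. Summing one
    witness per wall makes all pairings positive. *)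
Lemma open_chamber_nonempty : open_chamber H !=set0.
Proof.
have ex i : exists x, chamber setT x /\ 0 < << x , i >>.
  apply: contrapT => nex; have [U inU dimU] := exists_hyperplane i.
  have [_ /(_ U)] := linear_hullP (chamber setT).
  rewrite (lcs_span hHL) => fU.
  suff /dimvS : (fullv <= U)%VS by rewrite -dimU ltnn.
  apply: fU => x Cx; apply/inU/eqP; rewrite eq_le.
  have -> := (closed_chamberE _ _).1 Cx i I; rewrite andbT leNgt.
  by apply/negP => xi; apply: nex; exists x.
have [f fP] := choice ex.
exists (\sum_k f k); apply/open_chamberE => j; apply: pair_sum_gt0 => // [k _|].
  exact: (closed_chamberE _ _).1 (fP k).1 j I.
exact: (fP j).2.
Qed.

(** If all of wall [i] lay in hyperplane [k], both hyperplanes would be its linear hull, and walls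
    [i] and [k] would coincide. *)
Lemma wall_interior_nonempty i :
  exists q, << q , i >> = 0 /\ forall k, k != i -> 0 < << q , k >>.
Proof.
have [_ dimW] := (lcs_wall_face hHL (wall H i)).2 (ex_intro _ i erefl).
rewrite {2}/cone_dim (lcs_span hHL) in dimW.
have hullE k : (forall x, wall H i x -> << x , k >> = 0) ->
    forall x, x \in linear_hull (wall H i) <-> << x , k >> = 0.
  have [U inU dimU] := exists_hyperplane k => Wk.
  suff -> : linear_hull (wall H i) = U by [].
  apply/eqP; rewrite eqEdim -ltnS dimU -dimW leqnn andbT.
  by have [_] := linear_hullP (wall H i); apply=> x Wx; apply/inU/Wk.
have Wi x : wall H i x -> << x , i >> = 0 by move=> /wallE[].
have ex k : exists x, wall H i x /\ (k != i -> 0 < << x , k >>).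
  have [->|ki] := eqVneq k i.
    by exists 0; split=> //; apply/wallE; split; rewrite ?pair0 //;
       apply/closed_chamberE => j _; rewrite pair0.
  apply: contrapT => nex.
  have Wk x : wall H i x -> << x , k >> = 0.
    move=> Wx; apply/eqP; rewrite eq_le; have /wallE[Cx _] := Wx.
    have -> := (closed_chamberE _ _).1 Cx k I; rewrite andbT leNgt.
    by apply/negP => xk; apply: nex; exists x.
  case/eqP: ki; apply: (lcs_wall_inj hHL); apply/seteqP.
  by split=> x /wallE[Cx x0]; apply/wallE; split=> //;
    [apply/(hullE i Wi)/(hullE k Wk) | apply/(hullE k Wk)/(hullE i Wi)].
have [f fP] := choice ex.
exists (\sum_(k | k != i) f k); split=> [|k ki].
  by rewrite pair_sum big1 // => k _; exact/Wi/(fP k).1.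
apply: pair_sum_gt0 => // [j _|]; last exact: (fP k).2.
by have /wallE[/closed_chamberE + _] := (fP j).1; exact.
Qed.

(** * Freeness of the action and sides of hyperplanes *)

Lemma coxgroup_bij J s : coxgroup J s ->
  (forall x, (s^-1)%VF (s x) = x) /\ (forall x, s ((s^-1)%VF x) = x).
Proof.
move=> /coxgroup_lker0 s0; split=> x; first exact: lker0_lfunK.
exact: lker0_lfunVK.
Qed.

Lemma open_chamber_free s c : coxgroup setT s -> open_chamber H c ->
  open_chamber H (s c) -> forall x, s x = x.
Proof.
move=> Ws Cc Csc x; have [->|s1] := eqVneq s \1%VF; first by rewrite id_lfunE.
have := lcs_free hHL Ws s1; rewrite -subset0 => /(_ (s c))[].
by split=> //; exists c.
Qed.

Lemma open_chamberDZ c x (a b : R) : 0 < a -> 0 < b ->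
  open_chamber H c -> open_chamber H x -> open_chamber H (a *: c + b *: x).
Proof.
move=> a0 b0 /open_chamberE Cc /open_chamberE Cx; apply/open_chamberE => i.
by rewrite pairD !pairZ addr_gt0 // mulr_gt0.
Qed.

(* A chamber meeting a reflecting hyperplane would meet its mirror image. *)
Lemma chamber_pair_neq0 s j c : coxgroup setT s -> open_chamber H c ->
  << s c , j >> != 0.
Proof.
move=> Ws Cc; apply/negP; rewrite -sigma_fix => /eqP sc.
have [sK sVK] := coxgroup_bij Ws.
have Wt : coxgroup setT (s^-1 \o (sigma j \o s))%VF.
  apply: coxgroup_comp; first exact: coxgroup_inv.
  by apply: coxgroup_comp => //; exact: coxgroup_gen.
have tc : (s^-1 \o (sigma j \o s))%VF c = c by rewrite !comp_lfunE sc sK.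
(* Freeness makes the conjugate reflection trivial, although it negates the preimage of [root j]. *)
have := open_chamber_free Wt Cc; rewrite tc => /(_ Cc ((s^-1)%VF (root j))).
rewrite !comp_lfunE => /(congr1 s); rewrite !sVK => /eqP.
by rewrite sigma_fix; have [-> _] := rootP j; rewrite pnatr_eq0.
Qed.

Lemma chamber_side s j : coxgroup setT s ->
  (forall c, open_chamber H c -> 0 < << s c , j >>) \/
  (forall c, open_chamber H c -> << s c , j >> < 0).
Proof.
move=> Ws.
have same c c' : open_chamber H c -> open_chamber H c' ->
    0 < << s c , j >> -> 0 < << s c' , j >>.
  move=> Cc Cc' sc; rewrite lt_def chamber_pair_neq0 // leNgt; apply/negP => sc'.
  (* The weights put the image of this chamber point under [s] on hyperplane [j]. *)
  have Cd : open_chamber H ((- << s c' , j >>) *: c + << s c , j >> *: c').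
    by apply: open_chamberDZ; rewrite ?oppr_gt0.
  have /eqP[] := chamber_pair_neq0 j Ws Cd.
  rewrite linearD !linearZ /= pairD !pairZ; lra.
have [c0 Cc0] := open_chamber_nonempty.
have [s0|s0] := ltP 0 << s c0 , j >>; [left=> c Cc; exact: same s0|right=> c Cc].
rewrite lt_def eq_sym chamber_pair_neq0 //= leNgt; apply/negP => sc.
by have := same _ _ Cc Cc0 sc; rewrite ltNge s0.
Qed.

(** Carries strict inequalities on the open chamber over to its closure without limits. *)
Lemma ge0_of_perturb (a b : R) : (forall e, 0 < e -> 0 < a + e * b) -> 0 <= a.
Proof.
move=> ab; rewrite leNgt; apply/negP => a0.
have b0 : 0 < b by have := ab 1 ltr01; lra.
have := ab (- a / b) _; rewrite divr_gt0 ?oppr_gt0 // => /(_ isT).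
by rewrite divfK ?gt_eqF // subrr ltxx.
Qed.

(* If [H j] separates the adjacent chambers [v C] and [v (sigma i C)], it
   supports their common facet, so [v^-1 sigma_j v sigma_i] fixes the wall [i]
   pointwise and keeps the side of it on which [C] lies; near the wall it then
   maps points of [C] into [C], and by freeness it is trivial. *)
Lemma separating_reflection v i j : coxgroup setT v ->
  (forall c, open_chamber H c -> 0 < << v c , j >>) ->
  (forall c, open_chamber H c -> << v (sigma i c) , j >> < 0) ->
  forall x, sigma j (v (sigma i x)) = v x.
Proof.
move=> Wv vC vsC; have [q [qi qk]] := wall_interior_nonempty i.
have [c Cc] := open_chamber_nonempty.
have [vK vVK] := coxgroup_bij Wv.
(* Chamber points [p + e *: c] approach [p], and [sigma i] fixes [p], so [v p] is on both closed
   sides of hyperplane [j]. *)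
have facet0 p : << p , i >> = 0 -> (forall k, k != i -> 0 < << p , k >>) ->
    << v p , j >> = 0.
  move=> pi pk.
  have Cp e : 0 < e -> open_chamber H (p + e *: c).
    move=> e0; apply/open_chamberE => k; rewrite pairD pairZ.
    have ck : 0 < e * << c , k >> by rewrite mulr_gt0 // (open_chamberE _).1.
    have [kE|/pk pk0] := eqVneq k i; last by rewrite addr_gt0.
    by rewrite kE pi add0r -kE.
  apply/eqP; rewrite eq_le; apply/andP; split; last first.
    apply: (@ge0_of_perturb _ << v c , j >>) => e /Cp /vC.
    by rewrite linearD linearZ /= pairD pairZ.
  rewrite -oppr_ge0; apply: (@ge0_of_perturb _ (- << v (sigma i c) , j >>)).
  move=> e /Cp /vsC; have /eqP sp : sigma i p == p by rewrite sigma_fix pi.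
  by rewrite !linearD !linearZ /= sp pairD pairZ; lra.
(* Every point of hyperplane [i] is a difference of two points to which [facet0] applies. *)
have hyper0 m : << m , i >> = 0 -> << v m , j >> = 0.
  move=> mi.
  have [N N0 NP] := exists_large_scale (fun k => << q , k >>) (fun k => << m , k >>).
  have : << v (m + N *: q) , j >> = 0.
    apply: facet0; first by rewrite pairD pairZ mi qi mulr0 addr0.
    by move=> k /qk /NP; rewrite pairD pairZ.
  by rewrite linearD linearZ /= pairD pairZ (facet0 q) // mulr0 addr0.
(* A functional vanishing on hyperplane [i] is a multiple of the pairing with [coroot i]; its value
   at [root i], where that pairing is [2], gives the factor. *)
pose K := << v (root i) , j >> / 2.
have vE x : << v x , j >> = << x , i >> * K.
  have := hyper0 (x - (<< x , i >> / 2) *: root i).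
  rewrite [v _]linearB /= [v (_ *: _)]linearZ /= !pairB !pairZ (rootP i).1.
  by rewrite divfK ?pnatr_eq0 // subrr => /(_ erefl); rewrite /K; lra.
have ci : 0 < << c , i >> by exact: (open_chamberE _).1.
have K0 : 0 < K by have := vC _ Cc; rewrite vE pmulr_rgt0.
pose g := (v^-1 \o (sigma j \o (v \o sigma i)))%VF.
have gE x : v (g x) = sigma j (v (sigma i x)) by rewrite !comp_lfunE vVK.
have gi : 0 < << g c , i >>.
  by rewrite -(pmulr_lgt0 _ K0) -vE gE pair_sigma oppr_gt0 vsC.
have gq : g q = q.
  rewrite !comp_lfunE; have /eqP -> : sigma i q == q by rewrite sigma_fix qi.
  have /eqP -> : sigma j (v q) == v q by rewrite sigma_fix facet0.
  exact: vK.
have [N N0 NP] := exists_large_scale (fun k => << q , k >>) (fun k => << g c , k >>).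
have Ccq : open_chamber H (c + N *: q).
  apply/open_chamberE => k; rewrite pairD pairZ.
  have ck : 0 < << c , k >> by exact: (open_chamberE _).1.
  have [kE|/qk qk0] := eqVneq k i; first by rewrite kE qi mulr0 addr0 -kE.
  by rewrite addr_gt0 // mulr_gt0.
have Cg : open_chamber H (g (c + N *: q)).
  apply/open_chamberE => k; rewrite linearD linearZ /= gq pairD pairZ.
  have [->|/qk /NP //] := eqVneq k i; by rewrite qi mulr0 addr0.
have Wg : coxgroup setT g.
  apply: coxgroup_comp; first exact: coxgroup_inv.
  apply: coxgroup_comp; first exact: coxgroup_gen.
  by apply: coxgroup_comp => //; exact: coxgroup_gen.
by move=> x; rewrite -gE (open_chamber_free Wg Ccq Cg).
Qed.

Lemma chamber_in_subchamber J w : coxgroup setT w ->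
  exists2 u, coxgroup J u &
    forall c j, open_chamber H c -> J j -> 0 < << u (w c) , j >>.
Proof.
(* Membership of [w] is carried along because word induction supplies only the property of the
   prefix. *)
move=> Ww; suff [] : coxgroup setT w /\ exists2 u, coxgroup J u &
    forall c j, open_chamber H c -> J j -> 0 < << u (w c) , j >> by [].
elim/coxgroup_word_ind: w / Ww => [|w i _ [Ww [u Wu uw]]].
  split; first exact: coxgroup_id.
  exists \1%VF; first exact: coxgroup_id.
  by move=> c j /open_chamberE Cc _; rewrite !id_lfunE.
split; first by apply: coxgroup_comp => //; exact: coxgroup_gen.
have Wv : coxgroup setT (u \o w)%VF.
  by apply: coxgroup_comp => //; exact: coxgroupW Wu.
have [neg|pos] := pselect (exists2 j, J j &
    forall c, open_chamber H c -> << u (w (sigma i c)) , j >> < 0).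
  (* [sigma j] undoes the crossing: [separating_reflection] turns [sigma j (u (w (sigma i c)))] into
     [u (w c)]. *)
  have [j Jj sj] := neg; exists (sigma j \o u)%VF.
    by apply: coxgroup_comp => //; exact: coxgroup_gen.
  move=> c k Cc Jk; rewrite !comp_lfunE.
  have vC d : open_chamber H d -> 0 < << (u \o w)%VF d , j >>.
    by move=> Cd; rewrite comp_lfunE; exact: uw.
  have vsC d : open_chamber H d -> << (u \o w)%VF (sigma i d) , j >> < 0.
    by move=> Cd; rewrite comp_lfunE; exact: sj.
  have := separating_reflection Wv vC vsC c.
  by rewrite !comp_lfunE => ->; exact: uw.
exists u => // c j Cc Jj; rewrite comp_lfunE.
have Wvi : coxgroup setT ((u \o w) \o sigma i)%VF.
  by apply: coxgroup_comp => //; exact: coxgroup_gen.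
have [vj|vj] := chamber_side j Wvi; first by have := vj c Cc; rewrite !comp_lfunE.
by case: pos; exists j => // d /vj; rewrite !comp_lfunE.
Qed.

Lemma tits_cone_subchamber J x : tits_cone H L setT x ->
  exists2 u, coxgroup J u & chamber J (u x).
Proof.
move=> [w Ww [d /closed_chamberE Cd <-]].
have [u Wu uw] := chamber_in_subchamber J Ww; exists u => //.
have [c Cc] := open_chamber_nonempty.
apply/closed_chamberE => j Jj.
apply: (@ge0_of_perturb _ << u (w c) , j >>) => e e0.
have := uw (d + e *: c) j; rewrite !linearD !linearZ /= pairD pairZ; apply=> //.
apply/open_chamberE => k; rewrite pairD pairZ ltr_wpDl ?Cd //.
by rewrite mulr_gt0 // (open_chamberE _).1.
Qed.

Lemma coxgroup_fix J s x : coxgroup J s -> (forall j, J j -> << x , j >> = 0) ->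
  s x = x.
Proof.
move=> Ws xJ; elim/coxgroup_word_ind: s / Ws => [|s j Jj sx]; first by rewrite id_lfunE.
by rewrite comp_lfunE; have /eqP -> : sigma j x == x by rewrite sigma_fix xJ.
Qed.

(** * Faces of invariant subcones *)

Section InvariantCones.
Variable Y : set dual.
Hypotheses (hY : convex_cone Y) (Y0 : Y 0) (hYX : Y `<=` tits_cone H L setT)
  (hYW : W_invariant H L setT Y).

Lemma coxgroup_invariant J s x : coxgroup J s -> Y x -> Y (s x).
Proof.
move=> Ws Yx; rewrite -(hYW (coxgroupW (@subsetT _ J) Ws)).
by exists x.
Qed.

Lemma face_image J s F : coxgroup J s -> is_face Y F -> is_face Y (s @` F).
Proof.
move=> Ws FK; have [[FD FZ] FY FP] := (is_faceP _ hY).1 FK.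
have [sK sVK] := coxgroup_bij Ws.
apply/(is_faceP _ hY); split.
- split=> [_ _ [x Fx <-] [y Fy <-]|a _ a0 [x Fx <-]].
    by exists (x + y); [exact: FD | rewrite linearD].
  by exists (a *: x); [exact: FZ | rewrite linearZ].
- by move=> _ [x Fx <-]; apply: coxgroup_invariant Ws (FY _ Fx).
- move=> x y Yx Yy [z Fz zE]; exists ((s^-1)%VF x); last exact: sVK.
  apply: (FP _ ((s^-1)%VF y)); try exact: coxgroup_invariant (coxgroup_inv Ws) _.
  by rewrite -[z]sK zE linearD in Fz.
Qed.

(** The image is a face containing the internal point [e], hence contains [F]; the inverse of [s]
    gives the other inclusion. *)
Lemma face_stable_of_fixed J s F e : coxgroup J s -> is_face Y F ->
  internal F e -> s e = e -> s @` F = F.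
Proof.
move=> Ws FY ie se; have [sK sVK] := coxgroup_bij Ws.
have [_ sFY _] := FY; have [Fe _] := ie.
have sub t : coxgroup J t -> t e = e -> F `<=` t @` F.
  move=> Wt te; apply: (internal_sub_face (face_image Wt FY) sFY ie).
  by exists e.
apply/seteqP; split; last exact: sub.
move=> _ [x Fx <-]; have [|y Fy <-] := sub _ (coxgroup_inv Ws) _ _ Fx.
  by rewrite -{1}se sK.
by rewrite sVK.
Qed.

(* Among the internal points of [F] in the closed chamber, take one lying on
   as few walls as possible. *)
Lemma Upsilon_generic_point F : Upsilon H Y F ->
  exists e, [/\ internal F e, chamber setT e &
    forall i, << e , i >> = 0 -> forall x, F x -> << x , i >> = 0].
Proof.
move=> [FaF [e0 [rie0 Ce0]]]; have [FY _] := FaF.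
have [Fc sFY _] := FY; have [FD FZ] := Fc.
pose walls (e : dual) := [set i : 'I_n | << e , i >> == 0]%SET.
pose P (m : nat) :=
  `[< exists e, [/\ internal F e, chamber setT e & #|walls e| = m] >].
have exP : exists m : nat, P m.
  exists #|walls e0|; apply/asboolP; exists e0.
  by split=> //; exact: ri_internal rie0.
case: (ex_minnP exP) => m /asboolP[e [ie Ce em]] m_min.
exists e; split=> // i ei x Fx.
pose J : set 'I_n := [set j | << e , j >> = 0].
have [u Wu Cux] := tits_cone_subchamber J (hYX (sFY _ Fx)).
have ue : u e = e by exact: coxgroup_fix Wu _.
have Fux : F (u x).
  by rewrite -(face_stable_of_fixed Wu FY ie ue); exists x.
have [N N0 NP] :=
  exists_large_scale (fun k => << e , k >>) (fun k => << u x , k >>).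
have Ce_ge0 k : 0 <= << e , k >> by exact: (closed_chamberE _ _).1 Ce k I.
(* Walls missing [e] are settled by the size of [N], walls through [e] by [u x] lying in the chamber
   of [J]. *)
pose e' := N *: e + u x.
have e'E k : << e' , k >> = << u x , k >> + N * << e , k >>.
  by rewrite pairD pairZ addrC.
have ie' : internal F e' by apply: internal_add => //; exact: internalZ.
have Ce' : chamber setT e'.
  apply/closed_chamberE => k _; rewrite e'E.
  have := Ce_ge0 k; rewrite le_eqVlt => /predU1P[ek|/NP /ltW //].
  by rewrite -ek mulr0 addr0; exact: (closed_chamberE _ _).1 Cux k (esym ek).
have sub : (walls e' \subset walls e)%SET.
  apply/fintype.subsetP => k; rewrite !inE e'E => /eqP e'k.
  by rewrite eq_le Ce_ge0 andbT leNgt; apply/negP => /NP; rewrite e'k ltxx.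
have wE : walls e' = walls e.
  apply/eqP; rewrite eqEcard sub em; apply: m_min; apply/asboolP.
  by exists e'.
(* Both [e] and [e'] lie on the walls in [J], hence so does [u x], and then [u^-1] fixes it. *)
have uxJ j : J j -> << u x , j >> = 0.
  move=> ej; have : (j \in walls e) by rewrite inE ej.
  by rewrite -wE inE e'E ej mulr0 addr0 => /eqP.
have [uK _] := coxgroup_bij Wu.
have <- : u x = x by rewrite -[RHS]uK (coxgroup_fix (coxgroup_inv Wu) uxJ).
exact: uxJ.
Qed.

Lemma upsilon_lowerE F i :
  upsilon_lower H L F i <-> forall x, F x -> << x , i >> = 0.
Proof.
by split=> Fi x /Fi /eqP; [rewrite sigma_fix | rewrite -sigma_fix] => /eqP.
Qed.

(* An internal point of [F] strictly inside the half-space [i] and a point of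
   [F] outside it would have between them an internal point fixed by [sigma i]. *)
Lemma face_half_space F i : Upsilon H Y F -> ~ upsilon H L F i ->
  forall x, F x -> 0 <= << x , i >>.
Proof.
move=> UF nFi x Fx; rewrite leNgt; apply/negP => xi.
have [[FY _] _] := UF; have [Fc _ _] := FY; have [FD FZ] := Fc.
have [e [ie Ce eP]] := Upsilon_generic_point UF.
have ei : 0 < << e , i >>.
  rewrite lt_def ((closed_chamberE _ _).1 Ce i I) andbT.
  by apply/eqP => /eP /(_ _ Fx) xi0; rewrite xi0 ltxx in xi.
apply: nFi.
apply: (face_stable_of_fixed (J := setT)
  (e := (- << x , i >>) *: e + << e , i >> *: x)) => //.
- exact: coxgroup_gen.
- apply: internal_add => //; last exact: FZ.
  by apply: internalZ; rewrite ?oppr_gt0.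
- by apply/eqP; rewrite sigma_fix pairD !pairZ mulNr mulrC addNr.
Qed.

(** * The cone of differences and the interval from [R1] to [R2] *)

Variables R1 R2 : set dual.
Hypotheses (hR1 : Upsilon H Y R1) (hR2 : Upsilon H Y R2) (hR12 : R1 `<=` R2).
Let J := upsilon_lower H L R1 `&` upsilon_upper H L R2.

Let Y1 : is_face Y R1. Proof. by case: hR1 => [[]]. Qed.
Let Y2 : is_face Y R2. Proof. by case: hR2 => [[]]. Qed.
Let cone1 : convex_cone R1. Proof. by case: Y1. Qed.
Let cone2 : convex_cone R2. Proof. by case: Y2. Qed.
Let R1_0 : R1 0. Proof. by apply: face0 Y0 _; case: hR1. Qed.
Let R1Y : R1 `<=` Y. Proof. by case: Y1. Qed.
Let R2Y : R2 `<=` Y. Proof. by case: Y2. Qed.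

Lemma coxgroup_fix_lower s x : coxgroup J s -> R1 x -> s x = x.
Proof.
by move=> Ws Rx; apply: coxgroup_fix Ws _ => j [/upsilon_lowerE + _]; apply.
Qed.

Lemma coxgroup_image_upper s : coxgroup J s -> s @` R2 = R2.
Proof.
move=> Ws; elim/coxgroup_word_ind: s / Ws => [|s j [_ [Rj _]] sR].
  by apply/seteqP; split=> [_ [x Rx <-]|x Rx]; [|exists x => //]; rewrite id_lfunE.
have -> : (s \o sigma j)%VF @` R2 = s @` (sigma j @` R2).
  by rewrite image_comp; congr image; apply/funext => x; rewrite comp_lfunE.
by rewrite [sigma j @` R2]Rj.
Qed.

(** As [s] fixes [R1] pointwise, it commutes with subtracting [R1]. This serves both the invariance
    in (a) and the equivariance in (b). *)
Lemma coxgroup_image_sub s F : coxgroup J s ->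
  set_sub (s @` F) R1 = s @` set_sub F R1.
Proof.
move=> Ws; have fixR := coxgroup_fix_lower Ws.
apply/seteqP; split=> [_ [_ [x Fx <-] [r Rr <-]]|_ [_ [x Fx [r Rr <-]] <-]].
  exists (x - r); first by exists x => //; exists r.
  by rewrite linearB /= (fixR r).
exists (s x); first by exists x.
by exists r => //; rewrite linearB /= (fixR r).
Qed.

Lemma sub_tits_cone : set_sub R2 R1 `<=` tits_cone H L J.
Proof.
move=> _ [x Rx [r Rr <-]].
have [u Wu /closed_chamberE Cux] := tits_cone_subchamber J (hYX (R2Y Rx)).
have [uK _] := coxgroup_bij Wu.
exists (u^-1)%VF; first exact: coxgroup_inv.
exists (u (x - r)); last exact: uK.
apply/closed_chamberE => j Jj; have [/upsilon_lowerE r0 _] := Jj.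
by rewrite linearB /= (coxgroup_fix_lower Wu Rr) pairB (r0 _ Rr) subr0 Cux.
Qed.

Lemma sub_chamber_sub :
  set_sub R2 R1 `&` chamber J `<=`
  set_sub (R2 `&` chamber setT) (R1 `&` chamber setT).
Proof.
move=> _ [[x Rx [r Rr <-]] /closed_chamberE Cxr].
have [e [ie /closed_chamberE Ce eP]] := Upsilon_generic_point hR1.
have [Re eint] := ie; have [t t0 Rt] := eint _ Rr.
have [[_ Z1] [D2 _]] := (cone1, cone2).
(* Trades [r] for a multiple of the generic point: [x - r = y - t *: e], after which [N *: e] can be
   added to both terms. *)
pose y := x + (t *: e - r).
have R2y : R2 y by apply: D2 => //; exact: hR12.
have [N N0 NP] :=
  exists_large_scale (fun k => << e , k >>) (fun k => << y , k >>).
have tN : 0 < t + N by exact: addr_gt0.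
exists (y + N *: e).
  split; first by apply: D2 => //; apply: hR12; exact: Z1.
  apply/closed_chamberE => k _; rewrite pairD pairZ.
  have := Ce k I; rewrite le_eqVlt => /predU1P[/esym ek|/NP /ltW //].
  rewrite /y pairD pairB pairZ ek !mulr0 addr0 sub0r.
  have lk : upsilon_lower H L R1 k by apply/upsilon_lowerE; exact: eP.
  (* Wall [k] contains [R1]. Either [sigma k] moves [R2], which then lies in the half-space, or [k]
     is in [J], or [R2] lies on the wall too. *)
  have [uk|uk] := pselect (upsilon H L R2 k); last first.
    by rewrite (eP k ek r Rr) subr0; exact: face_half_space hR2 uk _ Rx.
  have [l2k|l2k] := pselect (upsilon_lower H L R2 k); last first.
    by rewrite -pairB; exact: Cxr.
  by rewrite (eP k ek r Rr) subr0 ((upsilon_lowerE _ _).1 l2k).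
exists ((t + N) *: e); first split; first exact: Z1.
  by apply/closed_chamberE => k _; rewrite pairZ mulr_ge0 ?Ce // ltW.
by rewrite /y scalerDl opprD addrACA subrr addr0 -addrA addrAC subrr sub0r.
Qed.

(** Together with [sub_chamber_sub] and [add_sub_chamber] this closes a cycle of inclusions, giving
    both equalities of (a). *)
Lemma sub_chamber_add :
  set_sub (R2 `&` chamber setT) (R1 `&` chamber setT) `<=`
  set_add (R2 `&` chamber setT) (set_sub R1 R1).
Proof.
move=> _ [x Rx [r [Rr _] <-]]; exists x => //; exists (- r) => //.
by exists 0 => //; exists r; rewrite ?sub0r.
Qed.

Lemma add_sub_chamber :
  set_add (R2 `&` chamber setT) (set_sub R1 R1) `<=`
  set_sub R2 R1 `&` chamber J.
Proof.
move=> _ [x [Rx /closed_chamberE Cx] [_ [r Rr [r' Rr' <-]] <-]]; split.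
  exists (x + r); last by exists r' => //; rewrite addrA.
  by have [D2 _] := cone2; apply: D2 => //; exact: hR12.
apply/closed_chamberE => j [/upsilon_lowerE r0 _].
by rewrite pairD pairB (r0 r) // (r0 r') // subr0 addr0 Cx.
Qed.

Lemma face_intervalE F : face_interval Y R1 R2 F ->
  [/\ is_face R2 F, R1 `<=` F & F `<=` R2].
Proof. by move=> [[FY _] R1F FR2]; split=> //; apply/(sub_face hY Y2 FR2). Qed.

Lemma face_interval_bij :
  set_bij (face_interval Y R1 R2) (Fa (set_sub R2 R1)) (fun F => set_sub F R1).
Proof.
have le F F' : face_interval Y R1 R2 F -> face_interval Y R1 R2 F' ->
    set_sub F R1 `<=` set_sub F' R1 -> F `<=` F'.
  move=> /face_intervalE[F2 _ _] /face_intervalE[F2' R1F' _].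
  exact: face_sub_le cone2 F2 F2' R1_0 R1F'.
split=> [F /face_intervalE[F2 R1F _]|F F' /set_mem IF /set_mem IF' FF'|G FaG].
- split; first exact: face_sub cone2 F2 cone1 R1F.
  by exists 0, 0; [exact: R1F | exists 0; rewrite ?subr0].
- by apply/seteqP; split; apply: le => //; rewrite FF'.
- have [GF RG GE] := face_sub_surj cone2 cone1 hR12 R1_0 FaG.
  exists (G `&` R2); last exact: GE.
  split=> //; split; first by apply/(sub_face hY Y2) => // x [].
  by exists 0; exact: RG.
Qed.

Lemma face_interval_sub_le F G : face_interval Y R1 R2 F ->
  face_interval Y R1 R2 G -> F `<=` G <-> set_sub F R1 `<=` set_sub G R1.
Proof.
move=> /face_intervalE[F2 _ _] /face_intervalE[G2 R1G _]; split.
  by move=> FG _ [x Fx [r Rr <-]]; exists x; [exact: FG | exists r].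
exact: face_sub_le cone2 F2 G2 R1_0 R1G.
Qed.

Lemma face_interval_image s F : coxgroup J s -> face_interval Y R1 R2 F ->
  face_interval Y R1 R2 (s @` F).
Proof.
move=> Ws [[FY [x Fx]] R1F FR2]; split.
- by split; [exact: face_image Ws FY | exists (s x), x].
- by move=> r Rr; exists r; [exact: R1F | exact: coxgroup_fix_lower Ws Rr].
- by rewrite -(coxgroup_image_upper Ws); exact: image_subset.
Qed.

End InvariantCones.
End CoxeterSystems.

Theorem theorem4p27 (R : realType) (h : vectType R) (n : nat) (hn : (0 < n)%N)
    (H : 'I_n -> set h) (L : 'I_n -> set 'Hom(h, R^o))
    (hHL : linear_coxeter_system H L)
    (Y : set 'Hom(h, R^o))
    (hY_cone : convex_cone Y) (hY0 : Y 0%R) (hYX : Y `<=` tits_cone H L setT)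
    (hYW : W_invariant H L setT Y)
    (R1 R2 : set 'Hom(h, R^o))
    (hR1 : Upsilon H Y R1) (hR2 : Upsilon H Y R2) (hR12 : R1 `<=` R2)
    (J : set 'I_n)
    (hJ : J = upsilon_lower H L R1 `&` upsilon_upper H L R2) :
  (* (a) *)
  [/\ convex_cone (set_sub R2 R1),
      W_invariant H L J (set_sub R2 R1),
      set_sub R2 R1 `<=` tits_cone H L J,
      set_sub R2 R1 `&` closed_chamber H J =
        set_add (R2 `&` closed_chamber H setT) (set_sub R1 R1) &
      set_sub R2 R1 `&` closed_chamber H J =
        set_sub (R2 `&` closed_chamber H setT) (R1 `&` closed_chamber H setT)]
  /\
  (* (b) *)
  [/\ set_bij (face_interval Y R1 R2) (Fa (set_sub R2 R1))
        (fun F => set_sub F R1),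
      (forall F G, face_interval Y R1 R2 F -> face_interval Y R1 R2 G ->
        (F `<=` G <-> set_sub F R1 `<=` set_sub G R1)),
      (forall s, coxgroup H L J s ->
        (forall F, face_interval Y R1 R2 F -> face_interval Y R1 R2 (s @` F)) /\
        (forall G, Fa (set_sub R2 R1) G -> Fa (set_sub R2 R1) (s @` G))),
      (forall s F, coxgroup H L J s -> face_interval Y R1 R2 F ->
        set_sub (s @` F) R1 = s @` set_sub F R1) &
      (forall F, face_interval Y R1 R2 F ->
        cone_dim (set_sub F R1) = cone_dim F)].
Proof.
subst J.
have c1 : convex_cone R1 by have [[[]]] := hR1.
have c2 : convex_cone R2 by have [[[]]] := hR2.
have R10 : R1 0%R by have [/(face0 hY0)] := hR1.
have interval_image := face_interval_image hHL hY_cone hYW (R1 := R1) (R2 := R2).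
have bij := face_interval_bij hY_cone hY0 hR1 hR2 hR12.
have [to_Fa _ surj] := bij.
have Ca := sub_chamber_sub hHL hY_cone hYX hYW hR1 hR2 hR12.
have ab := sub_chamber_add hY0 hR1 (R2 := R2).
have bC := add_sub_chamber hHL hR2 hR12.
split; split=> //.
- exact: convex_cone_sub.
- by move=> s Ws; rewrite -(coxgroup_image_sub hHL _ Ws) (coxgroup_image_upper hHL Ws).
- exact: (sub_tits_cone hHL hYX hR2 (R1 := R1)).
- by apply/seteqP; split=> // x /Ca /ab.
- by apply/seteqP; split=> // x /ab /bC.
- by move=> F G; exact: (face_interval_sub_le hY_cone hY0 hR1 hR2).
(* A face of the difference cone comes from the interval by surjectivity, and equivariance
   transports its image back. *)
- move=> s Ws; split=> [F|G /surj[F IF <-]]; first exact: interval_image.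
  by rewrite -(coxgroup_image_sub hHL _ Ws); exact/to_Fa/interval_image.
- by move=> s F Ws _; rewrite (coxgroup_image_sub hHL F Ws).
- by move=> F [_ R1F _]; exact: cone_dim_sub.
Qed.
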